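(* Let $A$ be an $n\times n$ sign pattern all of whose diagonal entries are nonzero, and let $\mathcal W$ be the perfect matching of the signed bipartite graph $G(A)$ given by the diagonal (row $i$ is matched with column $i$ for every $i$). Then: (1) The number of terms $t(A)$ in the determinant expansion of $A$ is one plus the cardinality of the set of all (nonempty) sets of pairwise disjoint $\mathcal W$-interlacing cycles of $G(A)$. (2) Let $\epsilon\in\{+,-\}$ be the sign of the product of the diagonal entries of $A$. Then the number $m_{-\epsilon}(A)$ of terms of sign $-\epsilon$ in the determinant expansion of $A$ equals the cardinality of the set of all sets of pairwise disjoint $\mathcal W$-interlacing cycles of $G(A)$ that contain an odd number of ($\mathcal W$-interlacing) e-cycles.
   Context: A sign pattern is a matrix $A$ each of whose entries is $A_{ij}$, $-A_{ij}$ or $0$, where the $A_{ij}$ are distinct free (commuting) variables. An entry $\pm A_{ij}$ has sign $\pm$. For square $A$, the determinant expansion of $A$ is $\det A$ regarded as a polynomial in the variables $A_{ij}$; each of its terms is $\pm$ a monomial. $t(A)$ is the number of terms, and $m_+(A)$, $m_-(A)$ are the numbers of terms with sign $+$, $-$ respectively. The signed bipartite graph $G(A)$ has one vertex for each row and one vertex for each column; there is an edge joining row $r$ and column $c$ iff the $(r,c)$ entry is nonzero, and this edge carries the sign of that entry. A cycle is a closed simple path (no repeated vertices except that start equals end), regarded as a subgraph; it has length at least $4$. Two edges meeting at the same column vertex and having the same sign form a c-pair. A cycle is an e-cycle if it contains an even number of c-pairs (pairs of consecutive cycle edges at a column of the cycle having the same sign), and an o-cycle if it contains an odd number. A perfect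 matching of $G(A)$ is a set of edges without common vertices covering all vertices; for a column $c$, $\mathcal W(c)$ denotes the row matched to it. A cycle of $G(A)$ is $\mathcal W$-interlacing if for every column $c$ that it touches it contains the edge $(c,\mathcal W(c))$. Disjoint cycles are cycles with no common vertices. The empty set is not counted as a set of cycles. *)

(* Defs.v *)
From mathcomp Require Import all_boot all_order all_algebra.
From mathcomp Require Import mpoly.

Set Implicit Arguments.
Unset Strict Implicit.
Unset Printing Implicit Defensive.

Import GRing.Theory.
Local Open Scope ring_scope.

(* The free variable A_ij is the indeterminate of index [mxvec_index i j];
   [mxvec_index] is a bijection between pairs (i, j) and 'I_(m * n).          *)
Definition entry_var m n (i : 'I_m) (j : 'I_n) : {mpoly int[m * n]} :=
  'X_(mxvec_index i j).

Definition sign_pattern m n (A : 'M[{mpoly int[m * n]}]_(m, n)) : Prop :=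
  forall i j, [\/ A i j = entry_var i j, A i j = - entry_var i j | A i j = 0].

(* Signs are the integers 1 and -1.  [term_sign] is only meant to be applied
   to a single term + x or - x, with x a monomial, whose leading coefficient
   is its only coefficient; it is 0 on the zero polynomial.                   *)
Definition term_sign k (p : {mpoly int[k]}) : int := Num.sg (mleadc p).

(* t(A) *)
Definition nb_terms n (A : 'M[{mpoly int[n * n]}]_n) : nat :=
  size (msupp (\det A)).

(* m_+(A) for e = 1 and m_-(A) for e = -1 *)
Definition nb_terms_of_sign (e : int) n (A : 'M[{mpoly int[n * n]}]_n) : nat :=
  count (fun x => Num.sg (\det A)@_x == e) (msupp (\det A)).

(* In the signed bipartite graph, [inl r] is the vertex of row r and [inr c] the
   vertex of column c; the edge joining them is represented by (r, c).        *)
Notation vertex_of m n := ('I_m + 'I_n)%type.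
Notation edge_of m n := ('I_m * 'I_n)%type.

Section SignedBipartiteGraph.

Variables (m n : nat) (A : 'M[{mpoly int[m * n]}]_(m, n)).
Local Notation vertex := (vertex_of m n).
Local Notation edge := (edge_of m n).

Definition edges : {set edge} := [set e : edge | A e.1 e.2 != 0].

Definition adjacent : rel vertex := fun u v =>
  match u, v with
  | inl r, inr c => (r, c) \in edges
  | inr c, inl r => (r, c) \in edges
  | _, _ => false
  end.

Definition edge_sign (e : edge) : int := term_sign (A e.1 e.2).

(* The edges joining cyclically consecutive vertices of p.  As [next p v] is v
   when v does not occur in p, neither equation below holds in that case.     *)
Definition cycle_edges (p : seq vertex) : {set edge} :=
  [set e : edge | (next p (inl e.1 : vertex) == inr e.2)
               || (next p (inr e.2 : vertex) == inl e.1)].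

(* A cycle, as a subgraph, is given by its set of edges.  The bound on the size
   of p is implied by its having no repeated vertex, see [is_cycleP].         *)
Definition is_cycle (C : {set edge}) : bool :=
  [exists p : {bseq #|{: vertex}| of vertex},
    [&& ucycleb adjacent p, (4 <= size p)%N & C == cycle_edges p]].

Lemma is_cycleP (C : {set edge}) :
  reflect (exists p : seq vertex,
             [/\ ucycle adjacent p, (4 <= size p)%N & C = cycle_edges p])
          (is_cycle C).
Proof.
apply: (iffP existsP) => [[p /and3P[cp sp /eqP ->]]|[p [cp sp ->]]].
  by exists p.
have szp : (size p <= #|{: vertex}|)%N.
  by case/andP: cp => _ /card_uniqP <-; apply: max_card.
by exists (Bseq szp); apply/and3P.
Qed.

Definition vertices_of (C : {set edge}) : {set vertex} :=
  [set v | [exists e in C, (v == inl e.1) || (v == inr e.2)]].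

Definition c_pair (e f : edge) : bool :=
  [&& e != f, e \in edges, f \in edges, e.2 == f.2 &
      edge_sign e == edge_sign f].

(* unordered pairs *)
Definition c_pairs_in (C : {set edge}) : {set {set edge}} :=
  [set [set e; f] | e in C, f in C & c_pair e f].

Definition e_cycle (C : {set edge}) : bool :=
  is_cycle C && ~~ odd #|c_pairs_in C|.

Definition perfect_matching (W : {set edge}) : bool :=
  [&& W \subset edges,
      [forall r : 'I_m, #|[set e in W | e.1 == r]| == 1%N] &
      [forall c : 'I_n, #|[set e in W | e.2 == c]| == 1%N]].

Definition interlacing (W C : {set edge}) : bool :=
  [forall c : 'I_n, ((inr c : vertex) \in vertices_of C) ==>
     [exists r : 'I_m, (((r, c) : edge) \in W) && (((r, c) : edge) \in C)]].

Definition disjoint_cycle_sets (W : {set edge}) : {set {set {set edge}}} :=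
  [set S : {set {set edge}} |
    [&& S != set0,
        [forall C in S, is_cycle C && interlacing W C] &
        [forall C in S, forall D in S,
           (C != D) ==> [disjoint vertices_of C & vertices_of D]]]].

End SignedBipartiteGraph.

Definition diag_matching n : {set edge_of n n} := [set (i, i) | i : 'I_n].

Lemma diag_matching_perfect n (A : 'M[{mpoly int[n * n]}]_n) :
  (forall i, A i i != 0) -> perfect_matching A (diag_matching n).
Proof.
move=> Ad; apply/and3P; split.
- by apply/subsetP => _ /imsetP[i _ ->]; rewrite inE.
- apply/forallP => i; apply/cards1P; exists (i, i).
  apply/setP => e; rewrite !inE; apply/andP/eqP => [[]|->].
    by case/imsetP => j _ -> /eqP /= ->.
  by split=> //; apply: imset_f.
- apply/forallP => i; apply/cards1P; exists (i, i).
  apply/setP => e; rewrite !inE; apply/andP/eqP => [[]|->].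
    by case/imsetP => j _ -> /eqP /= ->.
  by split=> //; apply: imset_f.
Qed.

(* Main.v *)
Require Import Defs.
From mathcomp Require Import all_boot all_order all_algebra.
From mathcomp Require Import mpoly.
From mathcomp Require Import fingroup perm.

Import GRing.Theory Num.Theory.
Local Open Scope ring_scope.

Set Implicit Arguments.
Unset Strict Implicit.
Unset Printing Implicit Defensive.

(* The terms of det A are the permutations s with all A_{i,s(i)} nonzero; as the
   entries are distinct variables, distinct permutations give distinct monomials
   and nothing cancels.  A diagonal-interlacing cycle of G(A) alternates diagonal
   edges (i, i) with edges (i, s i), where i runs over a cyclic sequence of at
   least two indices.  Hence the sets of disjoint interlacing cycles, together
   with the empty set, correspond to the permutations, each permutation being
   sent to the cycles given by its nontrivial orbits.  Relative to the diagonal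
   term, an orbit of length k contributes the sign (-1)^(k-1) of a k-cycle and a
   factor -1 for each of its columns that is not a c-pair, so with p c-pairs it
   contributes (-1)^(k-1) (-1)^(k-p) = (-1)^(p+1), which is -1 exactly when the
   cycle is an e-cycle. *)

(** * Induction along a cyclic sequence *)

Lemma next_ind (T : finType) (p : seq T) (P : T -> Prop) x :
    uniq p -> x \in p -> P x -> {in p, forall y, P y -> P (next p y)} ->
  {in p, forall y, P y}.
Proof.
move=> Up px Px IH y py.
(* On a duplicate-free p, [next p] has a single orbit, so y is an iterate of x. *)
have /iter_findex <- : fconnect (next p) x y.
  by rewrite (fconnect_cycle (cycle_next Up)).
elim: (findex _ _ _) => //= k; apply: IH.
by elim: k => //= k; rewrite mem_next.
Qed.

(** If two steps led back to x, the set of x and [next p x] would be closed under [next p] and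
    contain all of p. *)
Lemma next_next_neq (T : finType) (p : seq T) x :
  uniq p -> (2 < size p)%N -> x \in p -> next p (next p x) != x.
Proof.
move=> Up sz px; apply/negP => /eqP nnx.
have: {subset p <= [:: x; next p x]}.
  apply: (next_ind (P := fun y => y \in [:: x; next p x])) px _ _ => //.
    by rewrite !inE eqxx.
  by move=> y _; rewrite !inE => /orP[] /eqP->; rewrite ?nnx eqxx ?orbT.
by move/(uniq_leq_size Up); rewrite leqNgt sz.
Qed.

(** * Cycles alternating diagonal and off-diagonal edges *)

Section AlternatingCycle.

Variable n : nat.
Local Notation vertex := (vertex_of n n).
Local Notation edge := (edge_of n n).
Implicit Types (q : seq 'I_n) (i j : 'I_n) (D : {set 'I_n}).

(** One form for two sources: [f := next q] for a cycle of the graph, [f := s] for an orbit of a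
    permutation s. *)
Definition alt_edges (f : 'I_n -> 'I_n) D : {set edge} :=
  [set e : edge | (e.1 \in D) && ((e.2 == e.1) || (e.2 == f e.1))].

(* Traversed in this order, column i comes just before row i, so that the other
   edges are (i, next q i). *)
Definition alt_seq q : seq vertex :=
  flatten [seq [:: inr i; inl i] | i <- q].

(** The successor function along [alt_seq q] when f is the one along q; [nextE] then computes [next]
    on [alt_seq q]. *)
Definition alt_step (f : 'I_n -> 'I_n) (v : vertex) : vertex :=
  match v with inr i => inl i | inl i => inr (f i) end.

Lemma inr_alt_seq q i : ((inr i : vertex) \in alt_seq q) = (i \in q).
Proof. by elim: q => //= j q IHq; rewrite !inE IHq. Qed.

Lemma inl_alt_seq q i : ((inl i : vertex) \in alt_seq q) = (i \in q).
Proof. by elim: q => //= j q IHq; rewrite !inE IHq. Qed.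

Lemma size_alt_seq q : size (alt_seq q) = (size q).*2.
Proof. by elim: q => //= j q ->. Qed.

Lemma uniq_alt_seq q : uniq (alt_seq q) = uniq q.
Proof.
by elim: q => //= j q IHq; rewrite inE /= inr_alt_seq inl_alt_seq IHq andbA andbb.
Qed.

Lemma alt_seq_cycle f q : fcycle f q -> fcycle (alt_step f) (alt_seq q).
Proof.
case: q => //= i q; rewrite eqxx /=.
(* The index closing the cycle stays fixed while the current index k varies. *)
elim: q {1 3}i => [|j q IHq] k /= /andP[/eqP fk]; first by rewrite fk eqxx.
by move=> /IHq cq; rewrite fk !eqxx.
Qed.

Lemma next_alt_seqr q i : uniq q -> i \in q ->
  next (alt_seq q) (inr i) = inl i.
Proof.
by move/cycle_next/alt_seq_cycle/nextE=> next_q qi; rewrite next_q ?inr_alt_seq.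
Qed.

Lemma next_alt_seql q i : uniq q -> i \in q ->
  next (alt_seq q) (inl i) = inr (next q i).
Proof.
by move/cycle_next/alt_seq_cycle/nextE=> next_q qi; rewrite next_q ?inl_alt_seq.
Qed.

Lemma cycle_edges_alt_seq q : uniq q ->
  cycle_edges (alt_seq q) = alt_edges (next q) [set i in q].
Proof.
move=> Uq; apply/setP => -[r c]; rewrite !inE /=.
have [qr|q'r] := boolP (r \in q).
  rewrite next_alt_seql //= orbC.
  have -> : (inr (next q r) == inr c :> vertex) = (c == next q r).
    by rewrite eq_sym.
  have [qc|q'c] := boolP (c \in q); first by rewrite next_alt_seqr.
  (* [next] fixes a vertex outside the sequence, so it cannot send column c to a row. *)
  rewrite [next _ (inr c)]next_nth inr_alt_seq (negbTE q'c).
  by have [Dc|] //= := eqVneq c r; rewrite Dc qr in q'c.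
rewrite [next _ (inl r)]next_nth inl_alt_seq (negbTE q'r) /=.
have [qc|q'c] := boolP (c \in q).
  rewrite next_alt_seqr //; apply: contraNF q'r => /eqP[<-] //.
by rewrite next_nth inr_alt_seq (negbTE q'c).
Qed.

(** A column can only be followed by the row of the same index, so p splits into pairs
    [inr k, inl k]; ending at column c excludes an incomplete last pair. Induction is on a length
    bound because two vertices are removed at a time. *)
Lemma alt_seq_path (e : rel 'I_n) i p c :
    path (fun u v => match u, v with
            | inr i, inl j => i == j
            | inl i, inr j => e i j
            | _, _ => false
          end) (inl i : vertex) (rcons p (inr c)) ->
  exists q, p = alt_seq q.
Proof.
elim: {p}(size p).+1 {-2}p i (ltnSn (size p)) => // m IHm [|v p] i.
  by exists [::].
case: v => [j|j] //; case: p => [|[k|k] p] //=; rewrite ?andbF // !ltnS.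
move=> sz /andP[_ /andP[/eqP-> /IHm]] /(_ (ltnW sz))[q ->].
by exists (k :: q).
Qed.

Lemma alt_seqP (e : rel 'I_n) p c :
    (inr c : vertex) \in p ->
    path.cycle (fun u v : vertex => match u, v with
            | inr i, inl j => i == j
            | inl i, inr j => e i j
            | _, _ => false
          end) p ->
  exists k q, rot k p = alt_seq q.
Proof.
move=> pc; have [k p' Dp] := rot_to pc; rewrite -(rot_cycle k) Dp => cp.
exists k; rewrite Dp; case: p' cp {Dp} => [|[i|i] p'] //= /andP[/eqP->].
by move=> /alt_seq_path[q ->]; exists (i :: q).
Qed.

Lemma cycle_edges_rot k p : uniq p ->
  cycle_edges (rot k p) = cycle_edges p :> {set edge}.
Proof. by move=> Up; apply/setP => e; rewrite !inE !next_rot. Qed.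

(** Reversal exchanges [next] and [prev], which only swaps the two directions in which an edge may
    be traversed. *)
Lemma cycle_edges_rev p : uniq p ->
  cycle_edges (rev p) = cycle_edges p :> {set edge}.
Proof.
move=> Up; apply/setP => e; rewrite !inE !next_rev //.
by rewrite !(can2_eq (next_prev Up) (prev_next Up)) orbC; congr (_ || _); rewrite eq_sym.
Qed.

Variable A : 'M[{mpoly int[n * n]}]_n.

Lemma adjacent_sym : ssrbool.symmetric (adjacent A).
Proof. by case=> [i|i] [j|j]. Qed.

Lemma next_inr p c : path.cycle (adjacent A) p -> inr c \in p ->
  exists r, next p (inr c) = inl r.
Proof. by move=> cp /(next_cycle cp); case: next => // r _; exists r. Qed.

Lemma next_inl p r : path.cycle (adjacent A) p -> inl r \in p ->
  exists c, next p (inl r) = inr c.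
Proof. by move=> cp /(next_cycle cp); case: next => // c _; exists c. Qed.

(** Rotated to start at a column, p becomes an [alt_seq q], twice as long as q; hence the bound 4 on
    p is the bound 2 on q. *)
Lemma diag_oriented_cycle p :
    ucycle (adjacent A) p -> (4 <= size p)%N ->
    (forall c, inr c \in p -> next p (inr c) = inl c) ->
  exists q, [/\ uniq q, (1 < size q)%N, {in q, forall i, A i (next q i) != 0}
              & cycle_edges p = alt_edges (next q) [set i in q]].
Proof.
move=> /andP[cp Up] sz diag_p.
have [c pc] : exists c, inr c \in p.
  case: p cp {Up diag_p} sz => // -[r|c] p cp _; last by exists c; rewrite inE eqxx.
  have [|c Dc] := @next_inl _ r cp; first by rewrite inE eqxx.
  by exists c; rewrite -Dc mem_next inE eqxx.
have [|k [q Dp]] := alt_seqP (e := fun i j => A i j != 0) pc.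
  apply: (cycle_from_next Up) => -[r|d] pv; last by rewrite diag_p //=.
  by move: (next_cycle cp pv); case: next => //= d; rewrite inE.
have Uq : uniq q by rewrite -uniq_alt_seq -Dp rot_uniq.
exists q; split=> //.
- by move: sz; rewrite -(size_rot k) Dp size_alt_seq (leq_double 2).
- move=> i qi; have pi : inl i \in p by rewrite -(mem_rot k) Dp inl_alt_seq.
  move: (next_cycle cp pi); rewrite -(next_rot k Up) Dp next_alt_seql //=.
  by rewrite inE.
by rewrite -cycle_edges_alt_seq // -Dp cycle_edges_rot.
Qed.

Lemma inr_vertices_cycle p c : path.cycle (adjacent A) p -> inr c \in p ->
  inr c \in vertices_of (cycle_edges p).
Proof.
move=> cp pc; have [r Dr] := next_inr cp pc.
rewrite inE; apply/existsP; exists (r, c).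
by rewrite inE /= Dr !eqxx ?orbT.
Qed.

Lemma inr_vertices_alt_edges (f : 'I_n -> 'I_n) D c :
    {in D, forall i, f i \in D} ->
  (inr c \in vertices_of (alt_edges f D)) = (c \in D).
Proof.
move=> fD; rewrite inE; apply/existsP/idP=> [[[r d]]|Dc].
  rewrite inE /= => /andP[/andP[Dr d_r] /eqP[->]].
  by case/orP: d_r => /eqP-> //; apply: fD.
by exists (c, c); rewrite inE /= Dc !eqxx.
Qed.

Lemma inl_vertices_alt_edges (f : 'I_n -> 'I_n) D r :
  (inl r \in vertices_of (alt_edges f D)) = (r \in D).
Proof.
rewrite inE; apply/existsP/idP=> [[[s c]]|Dr].
  by rewrite inE /= => /andP[/andP[Dr _]]; rewrite orbF => /eqP[->].
by exists (r, r); rewrite inE /= Dr !eqxx.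
Qed.

Lemma mem_diag_matching i j : ((i, j) \in diag_matching n) = (i == j).
Proof.
by apply/imsetP/eqP=> [[k _ [-> ->]] //|->]; exists j.
Qed.

Lemma interlacing_cycle_shape C :
    is_cycle A C -> interlacing (diag_matching n) C ->
  exists q, [/\ uniq q, (1 < size q)%N, {in q, forall i, A i (next q i) != 0}
              & C = alt_edges (next q) [set i in q]].
Proof.
case/is_cycleP=> p [ucp sz ->] /forallP int_p.
have [cp Up] := andP ucp.
have diag_p c : inr c \in p ->
    (next p (inl c) == inr c) || (next p (inr c) == inl c).
  move=> pc; have := int_p c; rewrite inr_vertices_cycle //= => /existsP[r].
  by rewrite mem_diag_matching => /andP[/eqP->]; rewrite inE.
(* If one diagonal edge is traversed from its column to its row, then they all
   are: otherwise the next column d would be entered from row d, which is the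
   row c just reached, and p would have length 2.  Else reverse p. *)
have [/existsP[c /andP[pc /eqP Dc]] | /existsPn noA]:=
   boolP [exists c, (inr c \in p) && (next p (inr c) == inl c)].
  apply: (diag_oriented_cycle ucp sz) => d.
  (* [next_ind] advances one vertex at a time, so at a row P speaks of the column that follows. *)
  pose P (v : vertex) := match v with
    | inr d => next p (inr d) = inl d
    | inl r => if next p (inl r) is inr d then next p (inr d) = inl d else True
    end.
  apply: (next_ind (P := P)) pc _ _ (inr d) => // -[r|e] pv /=.
    by have [f ->] := next_inl cp pv.
  move=> De; rewrite De /=.
  have [f Df] : exists f, next p (inl e) = inr f.
    by apply: next_inl => //; rewrite -De mem_next.
  have pf : inr f \in p by rewrite -Df -De !mem_next.
  rewrite Df; case/orP: (diag_p f pf) => /eqP // Bf.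
  have /(can_inj (prev_next Up))[Dfe] : next p (inl f) = next p (inl e) by rewrite Bf.
  have sz3 : (2 < size p)%N by apply: ltnW.
  by case/negP: (next_next_neq Up sz3 pv); rewrite De Df Dfe.
have [|||q [Uq szq Aq Dq]] := @diag_oriented_cycle (rev p).
- rewrite /ucycle rev_cycle rev_uniq Up andbT.
  by apply: sub_cycle cp => u v; rewrite adjacent_sym.
- by rewrite size_rev.
- move=> c; rewrite mem_rev next_rev // => pc.
  have := diag_p c pc; have := noA c; rewrite pc /= => /negbTE->.
  by rewrite orbF => /eqP<-; rewrite prev_next.
by exists q; rewrite -cycle_edges_rev.
Qed.

Lemma alt_edges_interlacing_cycle q :
    (forall i, A i i != 0) -> uniq q -> (1 < size q)%N ->
    {in q, forall i, A i (next q i) != 0} ->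
  is_cycle A (alt_edges (next q) [set i in q]) &&
  interlacing (diag_matching n) (alt_edges (next q) [set i in q]).
Proof.
move=> Ad Uq sz Aq; apply/andP; split; last first.
  apply/forallP=> c; rewrite inr_vertices_alt_edges; last first.
    by move=> i; rewrite !inE mem_next.
  apply/implyP=> qc; apply/existsP; exists c.
  by rewrite mem_diag_matching !inE /= eqxx andbT; rewrite inE in qc.
apply/is_cycleP; exists (alt_seq q); split.
- rewrite /ucycle uniq_alt_seq Uq andbT.
  apply: cycle_from_next; rewrite ?uniq_alt_seq // => -[i|i].
    by rewrite inl_alt_seq => qi; rewrite next_alt_seql //= inE Aq.
  by rewrite inr_alt_seq => qi; rewrite next_alt_seqr //= inE.
- by rewrite size_alt_seq (leq_double 2).
by rewrite cycle_edges_alt_seq.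
Qed.

End AlternatingCycle.

(** * Permutations and their nontrivial orbits *)

Section CycleDecomposition.

Variable n : nat.
Local Notation edge := (edge_of n n).
Implicit Types (s t : 'S_n) (q : seq 'I_n) (D O : {set 'I_n}).

Lemma eq_alt_edges (f g : 'I_n -> 'I_n) D :
  {in D, f =1 g} -> alt_edges f D = alt_edges g D.
Proof.
move=> fg; apply/setP => -[r c]; rewrite !inE /=.
by case Dr: (r \in D) => //=; rewrite fg.
Qed.

Lemma alt_edges_inj (f : 'I_n -> 'I_n) : injective (alt_edges f).
Proof.
move=> D E DE; apply/setP => i.
by rewrite -!(inl_vertices_alt_edges f) DE.
Qed.

Lemma mem_porbits s O x : O \in porbits s -> x \in O -> O = porbit s x.
Proof.
by case/imsetP=> y _ ->; rewrite -eq_porbit_mem => /eqP.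
Qed.

Lemma porbits_closed s O : O \in porbits s -> {in O, forall i, s i \in O}.
Proof.
move=> sO i Oi; rewrite (mem_porbits sO Oi).
exact: (mem_porbit s 1).
Qed.

Lemma porbit_next s q x :
  uniq q -> {in q, s =1 next q} -> x \in q -> porbit s x = [set i in q].
Proof.
move=> Uq Ds qx; apply/setP => y; rewrite inE; apply/idP/idP.
  case/porbitP=> k ->; rewrite permX.
  by elim: k => //= k IHk; rewrite Ds // mem_next.
apply: (next_ind (P := fun y => y \in porbit s x)) Uq qx (porbit_id s x) _ y => y qy.
by rewrite -Ds //; apply: porbits_closed; rewrite imset_f.
Qed.

Lemma porbit_fcycle s x : fcycle s (traject s x #|porbit s x|).
Proof.
have := card_porbit_neq0 s x; case Dm: #|_| => [|m] // _ /=.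
have Dx : iter m s (s x) = x by rewrite -iterSr -Dm iter_porbit.
by rewrite -[X in rcons _ X]Dx -trajectSr fpath_traject.
Qed.

(** Fixed points are left out because a cycle of the graph has at least two rows. *)
Definition nontrivial_porbits s := [set O in porbits s | (1 < #|O|)%N].

Lemma card_porbit_gt1 s x : (1 < #|porbit s x|)%N = (s x != x).
Proof.
apply/idP/idP=> [|sx].
  have := uniq_traject_porbit s x; case: #|_| => [|[|m]] //=.
  by rewrite inE negb_or eq_sym => /andP[/andP[]].
have := cards2 (s x) x; rewrite sx => <-; apply: subset_leq_card.
apply/subsetP=> y /set2P[]->; last exact: porbit_id.
exact: (mem_porbit s 1).
Qed.

Lemma mem_nontrivial_porbits s x :
  (porbit s x \in nontrivial_porbits s) = (s x != x).
Proof. by rewrite inE card_porbit_gt1 imset_f. Qed.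

Definition cycles_of_perm s := [set alt_edges s O | O in nontrivial_porbits s].

Lemma cover_cycles_of_perm s r c :
  ((r, c) \in cover (cycles_of_perm s)) = (s r != r) && ((c == r) || (c == s r)).
Proof.
apply/bigcupP/idP=> [[_ /imsetP[O sO ->]]|/andP[sr rc]].
  rewrite inE /= => /andP[Or ->]; rewrite andbT.
  have sO' : O \in porbits s by move: sO; rewrite inE => /andP[].
  by rewrite -mem_nontrivial_porbits -(mem_porbits sO').
exists (alt_edges s (porbit s r)); last by rewrite inE /= porbit_id.
by rewrite imset_f ?mem_nontrivial_porbits.
Qed.

(** The union of the cycles determines s: i is moved iff (i, i) is covered, and then (i, s i) is the
    only other covered edge in row i. *)
Lemma cycles_of_perm_inj : injective cycles_of_perm.
Proof.
move=> s t st; apply/permP=> i.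
have := cover_cycles_of_perm s i i; rewrite st cover_cycles_of_perm eqxx !andbT.
have := cover_cycles_of_perm s i (s i).
rewrite st cover_cycles_of_perm eqxx orbT andbT.
have [->|] := eqVneq (s i) i; have [->|] := eqVneq (t i) i => //=.
by move=> _ _ /eqP.
Qed.

Lemma cycles_of_perm_eq0 s : (cycles_of_perm s == set0) = (s == 1%g).
Proof.
apply/eqP/eqP=> [s0|->].
  apply/permP=> i; rewrite perm1; apply/eqP; apply: negbNE.
  rewrite -mem_nontrivial_porbits; apply/negP=> /(imset_f (alt_edges s)).
  by rewrite -/(cycles_of_perm s) s0 inE.
apply/setP=> C; rewrite !inE; apply/imsetP=> -[O].
rewrite inE => /andP[/imsetP[i _ ->]].
by rewrite card_porbit_gt1 perm1 eqxx.
Qed.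

(** * Correspondence with sets of disjoint interlacing cycles *)

Variable A : 'M[{mpoly int[n * n]}]_n.
Hypothesis Ad : forall i, A i i != 0.

Definition nonzero_perms : {set 'S_n} := [set s : 'S_n | [forall i, A i (s i) != 0]].

Lemma alt_edges_perm_cycle s O : s \in nonzero_perms ->
    O \in nontrivial_porbits s ->
  is_cycle A (alt_edges s O) && interlacing (diag_matching n) (alt_edges s O).
Proof.
rewrite !inE => /forallP As /andP[/imsetP[x _ ->] gt1].
set q := traject s x #|porbit s x|.
have Uq : uniq q by apply: uniq_traject_porbit.
have next_q := nextE (porbit_fcycle s x).
have Dq : porbit s x = [set i in q].
  by apply/setP=> y; rewrite inE porbit_traject.
have -> : alt_edges s (porbit s x) = alt_edges (next q) [set i in q].
  by rewrite Dq; apply: eq_alt_edges => i; rewrite inE => /next_q.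
apply: alt_edges_interlacing_cycle => //; first by rewrite size_traject.
by move=> i /next_q ->.
Qed.

(** The rows and the columns of [alt_edges s O] are both indexed by O, so cycles with a common
    vertex come from intersecting, hence equal, orbits. *)
Lemma cycles_of_perm_disjoint s : s \in nonzero_perms -> s != 1%g ->
  cycles_of_perm s \in disjoint_cycle_sets A (diag_matching n).
Proof.
move=> As s1; rewrite inE cycles_of_perm_eq0 s1 /=; apply/andP; split.
  apply/forallP=> C; apply/implyP=> /imsetP[O sO ->].
  exact: alt_edges_perm_cycle.
apply/forallP=> C; apply/implyP=> /imsetP[O sO ->].
apply/forallP=> D; apply/implyP=> /imsetP[Q sQ ->].
have pO: O \in porbits s by move: sO; rewrite inE => /andP[].
have pQ: Q \in porbits s by move: sQ; rewrite inE => /andP[].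
apply/implyP; apply: contraR => /pred0Pn[v /= /andP[vO vQ]].
suffices [i Oi Qi] : exists2 i, i \in O & i \in Q.
  by rewrite (mem_porbits pO Oi) -(mem_porbits pQ Qi).
case: v vO vQ => i; first by rewrite !inl_vertices_alt_edges; exists i.
by rewrite !inr_vertices_alt_edges; [exists i | exact: porbits_closed..].
Qed.

(** The permutation sends i to the column of the off-diagonal edge of S in row i; disjointness makes
    this edge unique and the map injective. *)
Lemma disjoint_cycle_sets_perm S :
    S \in disjoint_cycle_sets A (diag_matching n) ->
  exists2 s, s \in nonzero_perms & cycles_of_perm s = S.
Proof.
rewrite inE => /and3P[_ /forall_inP cycS /forall_inP disS].
have eqS C C' v : C \in S -> C' \in S -> v \in vertices_of C ->
    v \in vertices_of C' -> C = C'.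
  move=> SC SC' Cv C'v; apply: contraTeq C'v => neqCC'.
  by have /forall_inP/(_ _ SC')/implyP/(_ neqCC')/disjointFr -> := disS C SC.
have shapeS C : C \in S -> exists q,
   [/\ uniq q, (1 < size q)%N, {in q, forall i, A i (next q i) != 0}
     & C = alt_edges (next q) [set i in q]].
  by case/cycS/andP; apply: interlacing_cycle_shape.
(* The default makes f fix the indices that no cycle of S touches. *)
pose f i := odflt i [pick j | (j != i) && ((i, j) \in cover S)].
have f_next C q i : C \in S -> uniq q -> (1 < size q)%N ->
    C = alt_edges (next q) [set i in q] -> i \in q -> f i = next q i.
  move=> SC Uq sz Dc qi; rewrite /f; case: pickP => [j|/(_ (next q i))/=].
    case/andP=> ij /bigcupP[C' SC' C'ij].
    have C'i : inl i \in vertices_of C'.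
      by rewrite inE; apply/existsP; exists (i, j); rewrite C'ij eqxx.
    have eqC : C' = C.
      by apply: eqS C'i _ => //; rewrite Dc inl_vertices_alt_edges inE.
    by move: C'ij; rewrite eqC Dc inE /= (negbTE ij) => /andP[_ /eqP].
  (* The search cannot fail: [next q i = i] would leave i alone in q. *)
  have -> : (i, next q i) \in cover S.
    by apply/bigcupP; exists C; rewrite // Dc !inE /= qi eqxx orbT.
  rewrite andbT => /negbFE/eqP next_i.
  have: {subset q <= [:: i]}.
    apply: (next_ind (P := fun y => y \in [:: i])) Uq qi (mem_head _ _) _ => y _.
    by rewrite inE => /eqP->; rewrite next_i mem_head.
  by move/(uniq_leq_size Uq); rewrite leqNgt sz.
have f_cases i : (f i = i /\ forall C, C \in S -> inr i \notin vertices_of C) \/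
    exists C q, [/\ C \in S, uniq q, (1 < size q)%N,
       {in q, forall i, A i (next q i) != 0} /\ C = alt_edges (next q) [set i in q]
        & i \in q].
  have [/existsP[C /andP[SC Ci]]|/existsPn notS] :=
    boolP [exists C, (C \in S) && (inr i \in vertices_of C)].
    right; have [q [Uq sz Aq Dc]] := shapeS C SC; exists C, q; split=> //.
    move: Ci; rewrite Dc inr_vertices_alt_edges ?inE // => j.
    by rewrite !inE mem_next.
  left; split=> [|C SC]; last by have := notS C; rewrite SC.
  rewrite /f; case: pickP => //= j /andP[_ /bigcupP[C SC Cij]].
  have [q [_ _ _ Dc]] := shapeS C SC.
  case/negP: (notS C); rewrite SC Dc inr_vertices_alt_edges.
    by move: Cij; rewrite Dc inE /= => /andP[].
  by move=> k; rewrite !inE mem_next.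
(* A touched index and its image lie in the same cycle, so equal images put two indices in one
   cycle, where [next q] is injective, unless both are fixed. *)
have f_inj : injective f.
  have aux i j : f i = f j ->
     (forall C, C \in S -> inr i \notin vertices_of C) -> f i = i -> i = j.
    move=> fij notSi fi; case: (f_cases j) => [[fj _]|[C [q [SC Uq sz [_ Dc] qj]]]].
      by rewrite -fi fij fj.
    case/negP: (notSi C SC); rewrite Dc inr_vertices_alt_edges.
      by rewrite -fi fij (f_next C q) // inE mem_next.
    by move=> k; rewrite !inE mem_next.
  move=> i j fij; case: (f_cases i) => [[fi /aux]|]; first by apply.
  case=> C [q [SC Uq sz [_ Dc] qi]].
  case: (f_cases j) => [[fj notSj]|]; first by apply/esym/(aux j i).
  case=> C' [q' [SC' Uq' sz' [_ Dc'] qj]].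
  have fi : f i = next q i by apply: (f_next C).
  have fj : f j = next q' j by apply: (f_next C').
  have eqC : C = C'.
    apply: (eqS C C' (inl (f i))) => //.
      by rewrite fi Dc inl_vertices_alt_edges inE mem_next.
    by rewrite fij fj Dc' inl_vertices_alt_edges inE mem_next.
  have qj' : j \in q.
    have: inl j \in vertices_of C by rewrite eqC Dc' inl_vertices_alt_edges inE.
    by rewrite Dc inl_vertices_alt_edges inE.
  by apply: (can_inj (prev_next Uq)); rewrite -fi fij (f_next C q).
pose s := perm f_inj; have sE i : s i = f i by rewrite permE.
(* The orbit of s through an index of C is the whole index set of C, so it gives back C. *)
have cyc_porbit C q i : C \in S -> uniq q -> (1 < size q)%N ->
    C = alt_edges (next q) [set i in q] -> i \in q -> C = alt_edges s (porbit s i).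
  move=> SC Uq sz Dc qi.
  have s_next : {in q, s =1 next q} by move=> j qj; rewrite sE (f_next C q).
  rewrite (porbit_next Uq s_next qi) Dc; apply: eq_alt_edges => j.
  by rewrite inE => /s_next.
exists s.
  rewrite inE; apply/forallP=> i; rewrite sE.
  case: (f_cases i) => [[-> _] //|[C [q [SC Uq sz [Aq Dc] qi]]]].
  by rewrite (f_next C q) // Aq.
apply/setP=> C; apply/imsetP/idP=> [[O]|SC].
  rewrite inE => /andP[/imsetP[i _ ->]]; rewrite card_porbit_gt1 sE => si ->.
  case: (f_cases i) => [[fi _] //|[C' [q [SC' Uq sz [_ Dc] qi]]]].
    by rewrite fi eqxx in si.
  by rewrite -(cyc_porbit C' q).
have [q [Uq sz Aq Dc]] := shapeS C SC.
have [i qi] : exists i, i \in q.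
  by case: (q) sz => // i q' _; exists i; rewrite mem_head.
exists (porbit s i); last exact: (cyc_porbit C q).
rewrite mem_nontrivial_porbits -card_porbit_gt1.
rewrite (porbit_next Uq _ qi) ?cardsE ?(card_uniqP Uq) //.
by move=> j qj; rewrite sE (f_next C q).
Qed.

(** * c-pairs and the sign of a permutation *)

Definition column_signs_agree s i :=
  edge_sign A (i, s i) == edge_sign A (s i, s i).

Lemma nontrivial_porbits_moved s O i :
  O \in nontrivial_porbits s -> i \in O -> s i != i.
Proof.
rewrite inE => /andP[sO gt1] Oi.
by rewrite -card_porbit_gt1 -(mem_porbits sO Oi).
Qed.

(** The cycle meets column s i exactly in (i, s i) and (s i, s i), so each column carries at most
    one c-pair. *)
Lemma c_pairs_in_alt_edges s O : s \in nonzero_perms ->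
    O \in nontrivial_porbits s ->
  c_pairs_in A (alt_edges s O)
    = [set [set (i, s i); (s i, s i)] | i in [set i in O | column_signs_agree s i]].
Proof.
rewrite inE => /forallP As sO.
have pO: O \in porbits s by move: sO; rewrite inE => /andP[].
apply/setP=> P; apply/imset2P/imsetP=> [[[r c] [r' c']]|[i]].
  rewrite !inE /= => /andP[Or cr] /andP[/andP[Or' cr']].
  rewrite /c_pair /= => /and5P[neq _ _ /eqP Dc sgn] ->.
  (* Of two distinct edges at one column, exactly one is diagonal: two off-diagonal ones would
     coincide by injectivity of s. *)
  move: cr cr' neq sgn; rewrite -{c'}Dc => /orP[] /eqP Dr /orP[] /eqP Dr'.
  - by rewrite -Dr -Dr' eqxx.
  - subst r c => _ sgn; exists r'; last by rewrite setUC.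
    by rewrite inE Or' /column_signs_agree eq_sym.
  - by subst r' c => _ sgn; exists r; rewrite // inE Or.
  - by rewrite (perm_inj (etrans (esym Dr) Dr')) eqxx.
rewrite inE => /andP[Oi wi] ->.
exists (i, s i) (s i, s i) => //; first by rewrite inE /= Oi eqxx orbT.
rewrite inE [_ \in alt_edges _ _]inE /= eqxx porbits_closed //=.
rewrite /c_pair !inE /= As Ad eqxx (eqP wi) eqxx !andbT.
by apply: contraNneq (nontrivial_porbits_moved sO Oi) => -[<-].
Qed.

Lemma e_cycle_alt_edges s O : s \in nonzero_perms ->
    O \in nontrivial_porbits s ->
  e_cycle A (alt_edges s O) = ~~ odd #|[set i in O | column_signs_agree s i]|.
Proof.
move=> As sO; rewrite /e_cycle c_pairs_in_alt_edges //.
have /andP[-> _] := alt_edges_perm_cycle As sO; rewrite card_in_imset // => i j.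
(* The pair determines i: as s moves i, the edge (i, s i) cannot be the diagonal edge in the pair of
   j. *)
rewrite inE => /andP[Oi _] _ /setP/(_ (i, s i)).
have si := nontrivial_porbits_moved sO Oi.
rewrite !inE eqxx /= => /esym/orP[] /eqP[] // Di Dsi.
by rewrite Dsi -Di eqxx in si.
Qed.

(* Orbit by orbit: [odd_perm] is the parity of #T + #porbits, so each orbit O
   contributes 1 plus the number of its columns whose signs agree; this is 2 on
   a fixed point and 1 + (number of c-pairs) on a nontrivial orbit. *)
Lemma odd_nb_e_cycles s : s \in nonzero_perms ->
  odd #|[set C in cycles_of_perm s | e_cycle A C]|
    = odd_perm s (+) odd #|[set i | ~~ column_signs_agree s i]|.
Proof.
move=> As; set w := column_signs_agree s.
have -> : odd_perm s (+) odd #|[set i | ~~ w i]|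
    = odd (\sum_(O in porbits s) #|[set i in O | w i]|.+1).
  have Dw : (\sum_(O in porbits s) #|[set i in O | w i]|)%N = #|[set i | w i]|.
    rewrite -sum1_card.
    rewrite (partition_big (porbit s) (mem (porbits s))) /=; last first.
      by move=> i _; apply: imset_f.
    apply: eq_bigr => O sO; rewrite -sum1_card; apply: eq_bigl => i.
    rewrite !inE andbC; congr (_ && _); apply/idP/eqP=> [Oi | <-].
      by rewrite (mem_porbits sO Oi).
    exact: porbit_id.
  under eq_bigr do rewrite -addn1.
  (* [odd_perm] involves the number of all indices; split by w, its part outside w cancels modulo
     2. *)
  rewrite big_split /= Dw sum1_card oddD /odd_perm -(cardsC [set i | w i]).
  have -> : ~: [set i | w i] = [set i | ~~ w i] by apply/setP=> i; rewrite !inE.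
  by rewrite oddD; do 3!case: (odd _).
have -> : [set C in cycles_of_perm s | e_cycle A C] =
    [set alt_edges s O
      | O in [set O in nontrivial_porbits s | e_cycle A (alt_edges s O)]].
  apply/setP=> C; rewrite inE; apply/andP/imsetP=> [[/imsetP[O sO ->] eC]|[O]].
    by exists O; rewrite // inE sO.
  by rewrite inE => /andP[sO eC] ->; rewrite imset_f.
rewrite (card_imset _ (@alt_edges_inj s)) -sum1_card !(big_morph odd oddD (erefl _)).
rewrite [RHS]big_mkcond [LHS]big_mkcond; apply: eq_bigr => O _ /=.
rewrite inE; have [sO|] := boolP (O \in nontrivial_porbits s).
  rewrite e_cycle_alt_edges //; move: sO; rewrite inE => /andP[-> _] /=.
  by case: odd.
rewrite inE; case sO: (O \in porbits s) => //=.
have /imsetP[i _ DO] := sO; rewrite DO card_porbit_gt1 negbK => /eqP si.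
have -> : [set j in porbit s i | w j] = [set i].
  apply/setP=> j; rewrite !inE; apply/andP/eqP=> [[]|->].
    by case/porbitP=> k -> _; rewrite permX; elim: k => //= k ->.
  by rewrite porbit_id /w /column_signs_agree si eqxx.
by rewrite cards1.
Qed.

(** * Terms of the determinant and their signs *)

Hypothesis hA : sign_pattern A.

Lemma edge_signE i j : A i j = edge_sign A (i, j) *: entry_var i j.
Proof.
rewrite /edge_sign /term_sign /=; case: (hA i j) => ->.
- by rewrite /entry_var mleadXm mcoeffX eqxx sgr1 scale1r.
- by rewrite /entry_var mleadN mleadXm mcoeffN mcoeffX eqxx sgrN1 scaleN1r.
- by rewrite mleadc0 sgr0 scale0r.
Qed.

Lemma sgr_edge_sign e : Num.sg (edge_sign A e) = edge_sign A e.
Proof. by rewrite /edge_sign /term_sign sgr_id. Qed.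

Lemma edge_sign_eq0 i j : (edge_sign A (i, j) == 0) = (A i j == 0).
Proof. by rewrite /edge_sign /term_sign sgr_eq0 mleadc_eq0. Qed.

(** Serves to trade (i, s i) for the diagonal edge of its column, at the cost of -1 when their signs
    differ. *)
Lemma edge_signM i j k l : A i j != 0 -> A k l != 0 ->
  edge_sign A (i, j)
    = (-1) ^+ (edge_sign A (i, j) != edge_sign A (k, l)) * edge_sign A (k, l).
Proof.
rewrite -!edge_sign_eq0 /edge_sign /term_sign !sgr_eq0.
move: (mleadc _) (mleadc _) => x y /neqr0_sign<- /neqr0_sign<-.
by do 2!case: (_ < 0).
Qed.

(** The coefficient of the term of s, also when its product vanishes, since a zero entry has edge
    sign 0. *)
Definition perm_coef s : int := (-1) ^+ s * \prod_i edge_sign A (i, s i).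

Definition perm_mon s : 'X_{1.. n * n} := (\sum_i U_(mxvec_index i (s i)))%MM.

Lemma perm_coef_eq0 s : (perm_coef s == 0) = (s \notin nonzero_perms).
Proof.
rewrite mulf_eq0 signr_eq0 /= inE negb_forall prodf_seq_eq0.
apply/hasP/existsP=> [[i _]|[i]].
  by rewrite /= edge_sign_eq0; exists i; rewrite negbK.
by rewrite negbK => Ai; exists i; rewrite ?mem_index_enum //= edge_sign_eq0.
Qed.

Lemma perm_coefE s : s \in nonzero_perms ->
  perm_coef s = (-1) ^+ odd #|[set C in cycles_of_perm s | e_cycle A C]| * perm_coef 1%g.
Proof.
move=> As; rewrite odd_nb_e_cycles // /perm_coef odd_perm1 mul1r signr_addb -mulrA.
congr (_ * _); have {}As i : A i (s i) != 0 by move: As; rewrite inE => /forallP.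
under eq_bigr => i _ do rewrite (edge_signM (As i) (Ad (s i))).
rewrite big_split /= [X in _ * X](_ : _ = \prod_i edge_sign A (i, (1%g : 'S_n) i)).
  rewrite prodrXr signr_odd (_ : #|_| = \sum_i ~~ column_signs_agree s i)%N //.
  by rewrite -sum1_card big_mkcond; apply: eq_bigr => i _; rewrite inE; case: (~~ _).
(* As s i runs over all indices, the diagonal signs of the columns s i multiply to the sign of the
   diagonal. *)
by rewrite [RHS](reindex_inj (@perm_inj _ s)); apply: eq_bigr => i _; rewrite perm1.
Qed.

Lemma mxvec_index_inj (i j k l : 'I_n) :
  (mxvec_index i j == mxvec_index k l) = ((i, j) == (k, l)).
Proof.
have [f fK _] := @curry_mxvec_bij n n.
have fE a b : f (mxvec_index a b) = (a, b) by apply: (fK (a, b)).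
by apply/eqP/eqP=> [ijkl|[-> ->] //]; rewrite -(fE i) ijkl fE.
Qed.

(** The exponents form the permutation matrix of s, so the monomial determines s. *)
Lemma perm_monE s i j : perm_mon s (mxvec_index i j) = (s i == j) :> nat.
Proof.
rewrite mnm_sumE (bigD1 i) //= big1 ?addn0 => [|k ki].
  by rewrite mnm1E mxvec_index_inj xpair_eqE eqxx.
by rewrite mnm1E mxvec_index_inj xpair_eqE (negbTE ki).
Qed.

Lemma perm_mon_inj : injective perm_mon.
Proof.
move=> s t st; apply/permP=> i; apply/eqP.
by have := perm_monE s i (t i); rewrite st perm_monE eqxx; case: eqP.
Qed.

Lemma mpolyX_perm_mon s : 'X_[perm_mon s] = \prod_i entry_var i (s i).
Proof. by rewrite /perm_mon (big_morph _ (@mpolyXD _ _) (@mpolyX0 _ _)). Qed.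

Lemma det_sign_pattern : \det A = \sum_s perm_coef s *: 'X_[perm_mon s].
Proof.
apply: eq_bigr => s _; rewrite /perm_coef -scalerA mpolyX_perm_mon -scaler_prod.
rewrite scaler_sign -signr_odd oddb mulr_sign.
by congr (if _ then - _ else _); apply: eq_bigr => i _; rewrite edge_signE.
Qed.

Lemma mcoeff_det m : (\det A)@_m = \sum_s perm_coef s * (perm_mon s == m)%:R.
Proof.
rewrite det_sign_pattern raddf_sum /=.
by apply: eq_bigr => s _; rewrite mcoeffZ mcoeffX.
Qed.

Lemma mcoeff_det_perm s : (\det A)@_(perm_mon s) = perm_coef s.
Proof.
rewrite mcoeff_det (bigD1 s) //= eqxx mulr1 big1 ?addr0 // => t ts.
by rewrite (inj_eq perm_mon_inj) (negbTE ts) mulr0.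
Qed.

Lemma msupp_det : perm_eq (msupp (\det A)) [seq perm_mon s | s in nonzero_perms].
Proof.
apply: uniq_perm; first exact: msupp_uniq.
  by rewrite map_inj_uniq ?enum_uniq //; apply: perm_mon_inj.
move=> m; rewrite mcoeff_msupp; apply/idP/imageP=> [|[s As ->]].
  have [/existsP[s /andP[As /eqP<-]] _|/existsPn nos] :=
    boolP [exists s in nonzero_perms, perm_mon s == m]; first by exists s.
  rewrite mcoeff_det big1 ?eqxx // => s _; have := nos s.
  by rewrite negb_and -perm_coef_eq0 => /orP[/eqP->|/negbTE->]; rewrite ?mul0r ?mulr0.
by rewrite mcoeff_det_perm perm_coef_eq0 As.
Qed.

(** P is arbitrary so as to serve both the count of all terms and that of the terms of a given
    sign. *)
Lemma count_msupp_det (P : pred int) :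
  count (fun m => P (\det A)@_m) (msupp (\det A))
    = #|[set s in nonzero_perms | P (perm_coef s)]|.
Proof.
rewrite (seq.permP msupp_det) -sum1_count big_map big_enum_cond -sum1_card /=.
by apply: eq_bigl => s; rewrite mcoeff_det_perm [RHS]inE.
Qed.

Lemma perm1_nonzero : 1%g \in nonzero_perms.
Proof. by rewrite inE; apply/forallP=> i; rewrite perm1. Qed.

(** The identity is removed because it corresponds to the empty set, which does not count as a set
    of cycles. *)
Lemma card_disjoint_cycle_sets (P : pred {set {set edge}}) :
  #|[set S in disjoint_cycle_sets A (diag_matching n) | P S]|
    = #|[set s in nonzero_perms :\ 1%g | P (cycles_of_perm s)]|.
Proof.
rewrite -(card_imset _ cycles_of_perm_inj); apply/eq_card=> S.
rewrite inE; apply/andP/imsetP=> [[Sdis PS]|[s]].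
  have [s As Ds] := disjoint_cycle_sets_perm Sdis; exists s => //.
  rewrite !inE -cycles_of_perm_eq0 Ds PS; move: As; rewrite inE => ->.
  by move: Sdis; rewrite inE => /and3P[->].
rewrite inE => /andP[/setD1P[s1 As] Ps] ->; split=> //.
exact: cycles_of_perm_disjoint.
Qed.

Lemma term_sign_diag : term_sign (\prod_i A i i) = perm_coef 1%g.
Proof.
have -> : \prod_i A i i = perm_coef 1%g *: 'X_[perm_mon 1%g].
  rewrite /perm_coef odd_perm1 mul1r mpolyX_perm_mon -scaler_prod.
  by apply: eq_bigr => i _; rewrite perm1 edge_signE.
rewrite /term_sign mleadcZE mleadXm mcoeffX eqxx mulr1.
rewrite /perm_coef odd_perm1 mul1r (big_morph _ (@sgrM _) (@sgr1 _)).
by apply: eq_bigr => i _; apply: sgr_edge_sign.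
Qed.

End CycleDecomposition.

Theorem theorem2p9 (n : nat) (A : 'M[{mpoly int[n * n]}]_n)
    (hA : sign_pattern A) (hdiag : forall i : 'I_n, A i i != 0) :
  let W := diag_matching n in
  let eps := term_sign (\prod_(i < n) A i i) in
  nb_terms A = (1 + #|disjoint_cycle_sets A W|)%N
  /\ nb_terms_of_sign (- eps) A
     = #|[set S in disjoint_cycle_sets A W
           | odd #|[set C in S | e_cycle A C]| ]|.
Proof.
move=> W eps; split.
  rewrite /nb_terms -count_predT (count_msupp_det hA xpredT).
  have := card_disjoint_cycle_sets hdiag xpredT.
  rewrite !setIdE !setIT => ->.
  (* The extra 1 is the diagonal term, given by the identity. *)
  by rewrite (cardsD1 1%g (nonzero_perms A)) perm1_nonzero.
rewrite /nb_terms_of_sign (count_msupp_det hA (fun x => Num.sg x == - eps)).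
rewrite (card_disjoint_cycle_sets hdiag (fun S => odd #|[set C in S | e_cycle A C]|)).
apply: eq_card => s; rewrite !inE -cycles_of_perm_eq0.
have [As|] := boolP (s \in nonzero_perms A); last first.
  by rewrite inE => /negbTE->; rewrite andbF.
have := As; rewrite inE => ->; rewrite /= andbT.
have eps0 : eps != 0.
  by rewrite /eps term_sign_diag // perm_coef_eq0 perm1_nonzero.
(* As eps is 1 or -1, the factor (-1)^b changes it to its opposite exactly when b is true. *)
have eps_sign (b : bool) : (Num.sg ((-1) ^+ b * eps) == - eps) = b.
  rewrite sgrM /eps /term_sign sgr_id; move: eps0; rewrite sgr_eq0 => /neqr0_sign<-.
  by case: b; case: (_ < 0).
rewrite perm_coefE // -term_sign_diag // eps_sign.
(* For the identity both sides are false: the empty set is excluded on the right and has no e-cycle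
   on the left. *)
have [->|] //= := eqVneq (cycles_of_perm s) set0.
suffices -> : [set C in set0 | e_cycle A C] = set0 by rewrite cards0.
by apply/setP=> C; rewrite !inE.
Qed.
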